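(* Let $\operatorname{sm}$ and $\operatorname{cm}$ be the functions analytic near $0$ defined by $\operatorname{sm}'=\operatorname{cm}^2$, $\operatorname{cm}'=-\operatorname{sm}^2$, $\operatorname{sm}(0)=0$, $\operatorname{cm}(0)=1$. For a power series $f(u)=\sum_{\nu\ge0}a_\nu u^\nu/\nu!$ write $\int_0^\infty f(u)e^{-u/x}\,du:=\sum_{\nu\ge0}a_\nu\,\nu!\,x^{\nu+1}$ (formal Laplace transform). For sequences $(a_n)_{n\ge1}$, $(b_n)_{n\ge0}$ and a monomial $N$, write $$J[N;a,b]:=\cfrac{N}{1+b_0x^3-\cfrac{a_1x^6}{1+b_1x^3-\cfrac{a_2x^6}{1+b_2x^3-\ddots}}}.$$ Then, as formal power series in $x$: (1) $\int_0^\infty \operatorname{sm}(u)e^{-u/x}du=J[x^2;a,b]$ with $a_n=(3n-2)(3n-1)^2(3n)^2(3n+1)$, $b_n=2(3n+1)((3n+1)^2+1)$; (2) $\int_0^\infty \operatorname{sm}(u)^2e^{-u/x}du=J[2x^3;a,b]$ with $a_n=(3n-1)(3n)^2(3n+1)^2(3n+2)$, $b_n=2(3n+2)((3n+2)^2+1)$; (3) $\int_0^\infty \operatorname{sm}(u)^3e^{-u/x}du=J[6x^4;a,b]$ with $a_n=(3n)(3n+1)^2(3n+2)^2(3n+3)$, $b_n=2(3n+3)((3n+3)^2+1)$; (4) $\int_0^\infty \operatorname{cm}(u)e^{-u/x}du=J[x;a,b]$ with $a_n=(3n-2)^2(3n-1)^2(3n)^2$, $b_n=(3n-1)(3n)^2+(3n+1)^2(3n+2)$;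 (5) $\int_0^\infty \operatorname{sm}(u)\operatorname{cm}(u)e^{-u/x}du=J[x^2;a,b]$ with $a_n=(3n-1)^2(3n)^2(3n+1)^2$, $b_n=(3n)(3n+1)^2+(3n+2)^2(3n+3)$; (6) $\int_0^\infty \operatorname{sm}(u)^2\operatorname{cm}(u)e^{-u/x}du=J[2x^3;a,b]$ with $a_n=(3n)^2(3n+1)^2(3n+2)^2$, $b_n=(3n+1)(3n+2)^2+(3n+3)^2(3n+4)$. (In each case $b_0$ is the value of the $b_n$ formula at $n=0$, namely $4,20,60,2,12,40$ respectively.)
   Context: The integrals denote the formal transformation from exponential to ordinary generating functions described in the claim; no analytic convergence is asserted. The continued fractions are understood as formal power series in $x$.
   Formalization: The formal Laplace transform of Σ a_ν u^ν/ν! is taken to be Σ a_ν x^{ν+1}; the extra factor ν! in the stated definition is dropped, since with it (1) already fails at x^5 (−96 instead of −4). *)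

(* Defs.v *)
From HB Require Import structures.
From mathcomp Require Import all_boot all_order all_algebra.
From mathcomp Require Import all_classical all_reals all_analysis.
From mathcomp Require Import complex.

Set Implicit Arguments.
Unset Strict Implicit.
Unset Printing Implicit Defensive.

Import Order.TTheory GRing.Theory Num.Theory.
Import numFieldNormedType.Exports.

Local Open Scope classical_set_scope.
Local Open Scope ring_scope.

(* A formal power series in x over A is its coefficient sequence nat -> A.
   Sums and differences are the pointwise \+ and \-, but the product is the
   Cauchy product fps_mul, not the pointwise ring product on functions. *)
Section FormalPowerSeries.
Variable A : comNzRingType.
Implicit Types (f g N : nat -> A) (c : A).

(* c * x^k *)
Definition fps_mono c (k : nat) : nat -> A := fun n => if n == k then c else 0.

Definition fps_mul f g : nat -> A :=
  fun n => \sum_(i < n.+1) f i * g (n - i)%N.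

(* 1/g = \sum_k (1 - g)^k, valid when g has constant term 1: then (1 - g)^k has
   no term of degree < k, so that only k <= n contributes to the coefficient of
   x^n; see fps_mulV. *)
Definition fps_inv g : nat -> A :=
  fun n => \sum_(k < n.+1)
    iter k (fps_mul (fps_mono 1 0 \- g)) (fps_mono 1 0) n.

(* jtail a b d k is the tail of the continued fraction starting at level k,
     1/(1 + b_k x^3 - a_(k+1) x^6/(1 + b_(k+1) x^3 - ...)),
   truncated after d levels. *)
Fixpoint jtail (a b : nat -> A) (d k : nat) : nat -> A :=
  if d is d'.+1 then
    fps_inv ((fps_mono 1 0 \+ fps_mono (b k) 3)
             \- fps_mul (fps_mono (a k.+1) 6) (jtail a b d' k.+1))
  else fps_mono 0 0.

Definition jconvergent N (a b : nat -> A) (d : nat) : nat -> A :=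
  fps_mul N (jtail a b d 0).

(* F = J[N; a, b], the x-adic limit of the convergents: each coefficient of the
   convergents is eventually constant, equal to that of F.  The value of a at 0
   is irrelevant. *)
Definition eq_jfrac (F : nat -> A) N (a b : nat -> A) : Prop :=
  forall m, \forall d \near \oo, jconvergent N a b d m = F m.

(* The formal transform of \sum_n t_n u^n/n!, i.e. \sum_n t_n x^(n+1), since
   the integral of (u^n/n!) e^(-u/x) over [0, +oo[ is x^(n+1). *)
Definition formal_laplace (t : nat -> A) : nat -> A :=
  fun n => if n is m.+1 then t m else 0.

Lemma fps_mulV g : g 0%N = 1 -> fps_mul g (fps_inv g) =1 fps_mono 1 0.
Proof.
move=> g0; pose h := fps_mono 1 0 \- g.
pose p k := iter k (fps_mul h) (fps_mono 1 0).
have h0 : h 0%N = 0 by rewrite /h /= /fps_mono eqxx g0 subrr.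
have p_small k m : (m < k)%N -> p k m = 0.
  elim: k m => // k IHk m ltmk; rewrite /p iterS -/(p k) /fps_mul.
  apply: big1 => -[[|i] /= lti] _; first by rewrite h0 mul0r.
  rewrite IHk ?mulr0 //; case: m ltmk lti => // m; rewrite !ltnS => lemk leim.
  by rewrite subSS (leq_ltn_trans _ lemk) // leq_subr.
have one_mul f : fps_mul (fps_mono 1 0) f =1 f.
  move=> n; rewrite /fps_mul big_ord_recl subn0 /fps_mono /= mul1r big1 ?addr0 //.
  by move=> i _; rewrite /= mul0r.
move=> n.
have -> : fps_mul g (fps_inv g) n = \sum_(k < n.+1) fps_mul g (p k) n.
  rewrite /fps_mul exchange_big /=; apply: eq_bigr => i _.
  rewrite -mulr_sumr; congr (_ * _); rewrite /fps_inv -/h.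
  rewrite -(big_mkord xpredT (fun k => p k (n - i)%N)).
  rewrite -(big_mkord xpredT (fun k => p k (n - i)%N)).
  rewrite [RHS](big_cat_nat _ (n := (n - i).+1)) ?ltnS ?leq_subr //=.
  have -> : \sum_((n - i).+1 <= k < n.+1) p k (n - i)%N = 0.
    by rewrite big_nat big1 // => k /andP[/p_small].
  by rewrite addr0.
have tele k : fps_mul g (p k) n = p k n - p k.+1 n.
  rewrite /p iterS -/(p k) -[in p k n]one_mul /fps_mul -sumrB.
  by apply: eq_bigr => i _; rewrite -mulrBl /h /= opprB addrC subrK.
under eq_bigr do rewrite tele.
rewrite -(big_mkord xpredT (fun k => p k n - p k.+1 n)).
under eq_bigr do rewrite -opprB.
by rewrite sumrN telescope_sumr // p_small // sub0r opprK.
Qed.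

End FormalPowerSeries.

(* t_0, t_1, ... are the coefficients of the expansion of f at 0 as an
   exponential power series, convergent in a neighbourhood of 0. *)
Definition has_egf (K : numFieldType) (f : K -> K) (t : nat -> K) : Prop :=
  \forall u \near (0 : K),
    series (fun n => t n * u ^+ n / n`!%:R) @ \oo --> f u.

Definition analytic0 (K : numFieldType) (f : K -> K) : Prop :=
  exists t, has_egf f t.

(* The formal Laplace transform of f equals J[N; a, b]. *)
Definition laplace_eq_jfrac (K : numFieldType) (f : K -> K)
    (N a b : nat -> K) : Prop :=
  analytic0 f /\ forall t, has_egf f t -> eq_jfrac (formal_laplace t) N a b.

(* is_derive u 1 f l: the increment h in the difference quotient of f at u
   ranges over K, so this says f'(u) = l, with complex f' when K = R[i]. *)
Definition is_sm_cm (K : numFieldType) (sm cm : K -> K) : Prop :=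
  [/\ analytic0 sm /\ analytic0 cm,
      \forall u \near (0 : K), is_derive u (1 : K) sm (cm u ^+ 2),
      \forall u \near (0 : K), is_derive u (1 : K) cm (- sm u ^+ 2),
      sm 0 = 0 &
      cm 0 = 1].

(* Main.v *)
(** The cubic relation [sm^3 + cm^3 = 1] turns the third derivatives of
    [sm^n] and [sm^n * cm] into linear combinations of the functions of the same
    family with exponents [n - 3], [n], [n + 3].  The formal Laplace transform
    turns [d/du] into division by [x], so the transforms satisfy a three-term
    recurrence with step 3, and iterating it produces the continued fraction.
    The recurrence is purely formal; analysis only enters to show that products
    and derivatives of functions with convergent expansions have the expected
    expansions, the latter without completeness because the derivatives of [sm]
    and [cm] are given. *)
Require Import Defs.
From HB Require Import structures.
From mathcomp Require Import all_boot all_order all_algebra.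
From mathcomp Require Import all_classical all_reals all_analysis.
From mathcomp Require Import complex ring zify.

Set Implicit Arguments.
Unset Strict Implicit.
Unset Printing Implicit Defensive.

Import Order.TTheory GRing.Theory Num.Theory.
Import numFieldNormedType.Exports.
Local Open Scope ring_scope.

(** * Formal power series *)

(* The function type [nat -> A] itself carries the pointwise product. *)
Definition fps (A : comNzRingType) : Type := nat -> A.

Section FpsRing.
Variable A : comNzRingType.
Implicit Types f g h : fps A.

HB.instance Definition _ := gen_eqMixin (fps A).
HB.instance Definition _ := gen_choiceMixin (fps A).
HB.instance Definition _ := GRing.Zmodule.copy (fps A) (nat -> A).

Definition trunc_fps (n : nat) f : {poly A} := \poly_(i < n) f i.

(** Coefficient [n] of a Cauchy product only sees coefficients up to [n]. Truncating to polynomials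
    therefore transports the ring laws, and later the Leibniz rule, from [{poly A}]. *)
Lemma fps_mul_trunc f g m n : (n < m)%N ->
  fps_mul f g n = (trunc_fps m f * trunc_fps m g)`_n.
Proof.
move=> ltnm; rewrite coefM; apply: eq_bigr => i _; rewrite !coef_poly.
by rewrite (leq_ltn_trans _ ltnm) ?leq_ord // (leq_ltn_trans _ ltnm) ?leq_subr.
Qed.

Lemma fps_mulC : commutative (@fps_mul A : fps A -> fps A -> fps A).
Proof.
by move=> f g; apply/funext => n; rewrite !(@fps_mul_trunc _ _ n.+1) // mulrC.
Qed.

Lemma fps_mulA : associative (@fps_mul A : fps A -> fps A -> fps A).
Proof.
move=> f g h; apply/funext => n.
transitivity ((trunc_fps n.+1 f * (trunc_fps n.+1 g * trunc_fps n.+1 h))`_n).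
  rewrite coefM; apply: eq_bigr => i _.
  by rewrite coef_poly ltn_ord (@fps_mul_trunc _ _ n.+1) // ltnS leq_subr.
rewrite mulrA coefM; apply: eq_bigr => i _.
by rewrite coef_poly ltnS leq_subr (@fps_mul_trunc _ _ n.+1).
Qed.

Lemma fps_mul1f : left_id (fps_mono 1 0 : fps A) (@fps_mul A).
Proof.
move=> f; apply/funext => n; rewrite /fps_mul big_ord_recl subn0 /fps_mono /=.
by rewrite mul1r big1 ?addr0 // => i _; rewrite mul0r.
Qed.

Lemma fps_mulDl : left_distributive (@fps_mul A : fps A -> fps A -> fps A) +%R.
Proof.
move=> f g h; apply/funext => n.
rewrite -[RHS]/(fps_mul f h n + fps_mul g h n) /fps_mul -big_split.
by apply: eq_bigr => i _; rewrite /= -mulrDl.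
Qed.

Lemma fps_oner_neq0 : (fps_mono 1 0 : fps A) != 0.
Proof.
apply/eqP => /(congr1 (fun f : fps A => f 0%N)) /eqP.
by rewrite /fps_mono /= oner_eq0.
Qed.

HB.instance Definition _ := GRing.Zmodule_isComNzRing.Build (fps A)
  fps_mulA fps_mulC fps_mul1f fps_mulDl fps_oner_neq0.

Lemma fps_coef0 n : (0 : fps A) n = 0. Proof. by []. Qed.
Lemma fps_addE f g n : (f + g) n = f n + g n. Proof. by []. Qed.
Lemma fps_oppE f n : (- f) n = - f n. Proof. by []. Qed.
Lemma fps_mulE f g : f * g = fps_mul f g. Proof. by []. Qed.
Lemma fps_coef1 n : (1 : fps A) n = (n == 0%N)%:R.
Proof. by rewrite -[1]/(fps_mono 1 0 : fps A) /fps_mono; case: eqP. Qed.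
Lemma fps_coef0M f g : (f * g) 0%N = f 0%N * g 0%N.
Proof. by rewrite fps_mulE /fps_mul big_ord1. Qed.
Lemma fps_coef0X f k : (f ^+ k) 0%N = f 0%N ^+ k.
Proof. by elim: k => [|k IHk]; rewrite ?fps_coef1 // !exprS fps_coef0M IHk. Qed.
Lemma fps_natrE k n : (k%:R : fps A) n = (k%:R : A) * (n == 0%N)%:R.
Proof.
elim: k => [|k IHk]; first by rewrite mul0r.
by rewrite -!natr1 fps_addE IHk fps_coef1 mulrDl mul1r.
Qed.

Definition fpsC (c : A) : fps A := fps_mono c 0.
Definition fpsX : fps A := fps_mono 1 1.

Lemma fps_coefCM c f n : (fpsC c * f) n = c * f n.
Proof.
rewrite fps_mulE /fps_mul big_ord_recl subn0 big1 ?addr0 // => i _.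
by rewrite /fpsC /fps_mono mul0r.
Qed.

Lemma fpsC_is_zmod_morphism : zmod_morphism fpsC.
Proof.
move=> a b; apply/funext => n; rewrite fps_addE fps_oppE /fpsC /fps_mono.
by case: eqP => // _; rewrite subr0.
Qed.

Lemma fpsC_is_monoid_morphism : monoid_morphism fpsC.
Proof.
split=> // a b; apply/funext => n; rewrite fps_coefCM /fpsC /fps_mono.
by case: eqP => // _; rewrite mulr0.
Qed.

HB.instance Definition _ :=
  GRing.isZmodMorphism.Build A (fps A) fpsC fpsC_is_zmod_morphism.
HB.instance Definition _ :=
  GRing.isMonoidMorphism.Build A (fps A) fpsC fpsC_is_monoid_morphism.

Lemma fps_coefXM f n : (fpsX * f) n = if n is m.+1 then f m else 0.
Proof.
case: n => [|n]; first by rewrite fps_coef0M mul0r.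
rewrite fps_mulE /fps_mul 2!big_ord_recl big1 => [|i _]; last by rewrite mul0r.
by rewrite /fpsX /fps_mono /= mul0r mul1r add0r addr0 subSS subn0.
Qed.

Lemma fps_coefXnM k f n :
  (fpsX ^+ k * f) n = if (n < k)%N then 0 else f (n - k)%N.
Proof.
elim: k n => [|k IHk] [|n]; rewrite ?expr0 ?mul1r ?subn0 //.
  by rewrite exprS -mulrA fps_coefXM.
by rewrite exprS -mulrA fps_coefXM IHk ltnS subSS.
Qed.

Lemma fps_monoE c k : fps_mono c k = fpsC c * fpsX ^+ k :> fps A.
Proof.
apply/funext => n; rewrite mulrC fps_coefXnM /fpsC /fps_mono.
by rewrite eqn_leq subn_eq0; case: ltnP; rewrite ?andbF ?andbT.
Qed.

(** * Formal derivative and formal Laplace transform *)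

Definition fpsD f : fps A := fun n => f n.+1 *+ n.+1.

Lemma fpsD_add f g : fpsD (f + g) = fpsD f + fpsD g.
Proof. by apply/funext => n; rewrite /fpsD !fps_addE mulrnDl. Qed.

Lemma fpsD_opp f : fpsD (- f) = - fpsD f.
Proof. by apply/funext => n; rewrite /fpsD !fps_oppE mulNrn. Qed.

Lemma fpsD_mul f g : fpsD (f * g) = fpsD f * g + f * fpsD g.
Proof.
apply/funext => n; rewrite fps_addE /fpsD !fps_mulE.
rewrite (@fps_mul_trunc f g n.+2) // -coef_deriv derivM coefD !coefM.
congr (_ + _); apply: eq_bigr => i _; rewrite coef_deriv !coef_poly.
  by rewrite !ltnS leq_ord leqW // leq_subr.
by rewrite ltnS leqW ?leq_ord // !ltnS leq_subr.
Qed.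

Lemma fpsD_C c : fpsD (fpsC c) = 0.
Proof. by apply/funext => n; rewrite /fpsD /fpsC /fps_mono mul0rn. Qed.

Lemma fpsD_exp f n : fpsD (f ^+ n.+1) = n.+1%:R * f ^+ n * fpsD f.
Proof.
elim: n => [|n IHn]; first by rewrite expr1 expr0 !mul1r.
rewrite exprS fpsD_mul IHn -[n.+2%:R]natr1 [f ^+ n.+1]exprS; ring.
Qed.

(** Elements of [fps A] store ordinary coefficients; the factorial turns them into the exponential
    ones that [formal_laplace] expects. *)
Definition fps_laplace f : fps A :=
  formal_laplace (fun n => f n * n`!%:R).

Lemma fps_laplace_add f g : fps_laplace (f + g) = fps_laplace f + fps_laplace g.
Proof.
apply/funext => -[|n]; rewrite fps_addE /= ?addr0 //.
by rewrite /fps_laplace /= fps_addE mulrDl.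
Qed.

Lemma fps_laplace_opp f : fps_laplace (- f) = - fps_laplace f.
Proof.
apply/funext => -[|n]; rewrite fps_oppE /= ?oppr0 //.
by rewrite /fps_laplace /= fps_oppE mulNr.
Qed.

Lemma fps_laplaceCM c f : fps_laplace (fpsC c * f) = fpsC c * fps_laplace f.
Proof.
apply/funext => -[|n]; rewrite fps_coefCM /fps_laplace /= ?mulr0 //.
by rewrite fps_coefCM mulrA.
Qed.

(** Formal integration by parts, multiplied by [x]; the boundary term at 0 is [f 0 * x]. *)
Lemma fps_laplaceD f :
  fpsX * fps_laplace (fpsD f) = fps_laplace f - fpsC (f 0%N) * fpsX.
Proof.
apply/funext => n; rewrite fps_addE fps_oppE [fpsC _ * _]mulrC !fps_coefXM.
case: n => [|[|n]]; rewrite /fps_laplace /formal_laplace /fpsC /fps_mono ?subr0 //.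
  by rewrite fact0 mulr1 subrr.
by rewrite /fpsD -[f _ *+ _]mulr_natr factS natrM mulrA.
Qed.

Lemma fps_laplaceD3 f :
  fpsX ^+ 3 * fps_laplace (fpsD (fpsD (fpsD f))) =
    fps_laplace f - fpsC (f 0%N) * fpsX - fpsC (fpsD f 0%N) * fpsX ^+ 2
    - fpsC (fpsD (fpsD f) 0%N) * fpsX ^+ 3.
Proof.
rewrite 2!exprS expr1 -!mulrA fps_laplaceD mulrBr fps_laplaceD !mulrBr fps_laplaceD.
ring.
Qed.

End FpsRing.

Arguments fpsX {A}.

(** * Continued fractions from three-term recurrences *)

Section ContinuedFraction.
Variable A : comNzRingType.
Implicit Types (a b c : nat -> A) (F G : nat -> fps A).

(** The recursion for truncations with the denominator cleared. The denominator has constant term 1,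
    so [fps_mulV] applies. *)
Lemma jtailS a b d k :
  (jtail a b d.+1 k : fps A) * (1 + fpsC (b k) * fpsX ^+ 3
     - fpsC (a k.+1) * fpsX ^+ 6 * jtail a b d k.+1) = 1.
Proof.
rewrite mulrC -!fps_monoE; apply/funext => n; rewrite fps_mulE /=.
apply: fps_mulV.
rewrite -[LHS]/(fps_mono 1 0 0%N + fps_mono (b k) 3 0%N
  - fps_mul (fps_mono (a k.+1) 6) (jtail a b d k.+1) 0%N).
by rewrite /fps_mul big_ord1 /fps_mono mul0r addr0 subr0.
Qed.

(* The error [F k - T * G k] of the [d]-th truncation [T] at level [k] is a
   multiple of [x^3] times the error of the [(d-1)]-st truncation at level
   [k+1]. *)
Lemma jfrac_recurrence a b c F G :
  (forall k, F k * (1 + fpsC (b k) * fpsX ^+ 3) =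
             G k + fpsC (c k) * fpsX ^+ 3 * F k.+1) ->
  (forall k, fpsC (c k) * G k.+1 = fpsC (a k.+1) * fpsX ^+ 3 * F k) ->
  eq_jfrac (F 0%N) (G 0%N) a b.
Proof.
move=> rec stp m.
have err d k : exists h : fps A,
    F k - (jtail a b d k : fps A) * G k = fpsX ^+ (3 * d) * h.
  elim: d k => [|d IHd] k.
    exists (F k); rewrite muln0 expr0 mul1r.
    have -> : (jtail a b 0 k : fps A) = 0 :> fps A.
      by apply/funext => n; rewrite /= /fps_mono; case: eqP.
    by rewrite mul0r subr0.
  have [h hE] := IHd k.+1.
  exists (fpsC (c k) * jtail a b d.+1 k * h).
  have TE := jtailS a b d k.
  set T := (jtail a b d.+1 k : fps A) in TE *.
  set U := (jtail a b d k.+1 : fps A) in TE hE.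
  (* Multiplying [F k] by [T] times its denominator, which is 1, exposes the left side of [rec] and
     the right side of [stp]; neither [c k] nor [G k] has to be invertible. *)
  have -> : F k = T * (1 + fpsC (b k) * fpsX ^+ 3
     - fpsC (a k.+1) * fpsX ^+ 6 * U) * F k by rewrite TE mul1r.
  transitivity (T * (F k * (1 + fpsC (b k) * fpsX ^+ 3) - G k
    - fpsX ^+ 3 * U * (fpsC (a k.+1) * fpsX ^+ 3 * F k))); first by ring.
  rewrite rec -stp.
  transitivity (T * fpsX ^+ 3 * fpsC (c k) * (F k.+1 - U * G k.+1)); first by ring.
  rewrite hE mulnS exprD; ring.
(* The error at level 0 is divisible by [x^(3d)], so it has no coefficient of degree [m] once
   [d > m]. *)
exists m.+1 => // d /= ltmd; have [h hE] := err d 0%N.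
have -> : jconvergent (G 0%N) a b d m = ((jtail a b d 0 : fps A) * G 0%N) m.
  by rewrite mulrC.
move/(congr1 (fun f : fps A => f m)): hE.
rewrite fps_coefXnM ifT; last by rewrite (leq_trans ltmd) // leq_pmull.
by rewrite fps_addE fps_oppE => /subr0_eq ->.
Qed.

(** Transforming the differential system gives the three-term recurrence. Initial values survive
    only at level 0, where together with [Q] they form the numerator; [c] and [e] are the raising
    and lowering coefficients, whose products are the partial numerators. *)
Lemma jfrac_laplace a b c e (Q : fps A) F :
  fpsD (fpsD (fpsD (F 0%N))) =
    Q - fpsC (b 0%N) * F 0%N + fpsC (c 0%N) * F 1%N ->
  (forall k, fpsD (fpsD (fpsD (F k.+1))) =
     fpsC (e k) * F k - fpsC (b k.+1) * F k.+1 + fpsC (c k.+1) * F k.+2) ->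
  (forall k, [/\ F k.+1 0%N = 0, fpsD (F k.+1) 0%N = 0
               & fpsD (fpsD (F k.+1)) 0%N = 0]) ->
  (forall k, c k * e k = a k.+1) ->
  eq_jfrac (fps_laplace (F 0%N))
    (fpsX ^+ 3 * fps_laplace Q + fpsC (F 0%N 0%N) * fpsX
     + fpsC (fpsD (F 0%N) 0%N) * fpsX ^+ 2
     + fpsC (fpsD (fpsD (F 0%N)) 0%N) * fpsX ^+ 3 : fps A) a b.
Proof.
move=> D0 DS F0 ce.
pose G k := if k is k'.+1 then fpsC (e k') * fpsX ^+ 3 * fps_laplace (F k')
  else (fpsX ^+ 3 * fps_laplace Q + fpsC (F 0%N 0%N) * fpsX
     + fpsC (fpsD (F 0%N) 0%N) * fpsX ^+ 2
     + fpsC (fpsD (fpsD (F 0%N)) 0%N) * fpsX ^+ 3 : fps A).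
apply: (@jfrac_recurrence _ _ c (fun k => fps_laplace (F k)) G) => [[|k]|k].
- have := fps_laplaceD3 (F 0%N).
  rewrite D0 !fps_laplace_add fps_laplace_opp !fps_laplaceCM /G => /eqP.
  by rewrite -subr_eq0 => /eqP h; apply: subr0_eq; rewrite -[RHS]oppr0 -h; ring.
- have [F0k F1k F2k] := F0 k; have := fps_laplaceD3 (F k.+1).
  rewrite DS F0k F1k F2k !fps_laplace_add fps_laplace_opp !fps_laplaceCM /G => /eqP.
  by rewrite -subr_eq0 => /eqP h; apply: subr0_eq; rewrite -[RHS]oppr0 -h; ring.
- by rewrite /G -ce; ring.
Qed.
End ContinuedFraction.

(** * The formal Dixon functions *)

Section FormalDixon.
Variables (K : numFieldType) (S C : fps K).
Hypotheses (DS : fpsD S = C ^+ 2) (DC : fpsD C = - S ^+ 2).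
Hypotheses (S0 : S 0%N = 0) (C0 : C 0%N = 1).

(** The series [C^3 + S^3 - 1] has zero derivative and zero constant term, hence vanishes in
    characteristic 0. *)
Lemma dixon_cubes : C ^+ 3 = 1 - S ^+ 3.
Proof.
suff D0 : fpsD (C ^+ 3 + S ^+ 3 - 1) = 0.
  apply: subr0_eq; transitivity (C ^+ 3 + S ^+ 3 - 1); first by ring.
  apply/funext => -[|n].
    rewrite !fps_addE fps_oppE !fps_coef0X S0 C0 fps_coef1.
    by rewrite expr1n expr0n addr0 subrr.
  move/(congr1 (fun f : fps K => f n)): D0; rewrite /fpsD => /eqP.
  by rewrite mulrn_eq0 => /eqP.
rewrite !fpsD_add fpsD_opp !fpsD_exp -[1](rmorph1 (@fpsC K)) fpsD_C DS DC; ring.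
Qed.

Lemma fpsD_natr n : fpsD (n%:R : fps K) = 0.
Proof. by rewrite -(rmorph_nat (@fpsC K)) fpsD_C. Qed.

Lemma fpsD0 : fpsD (0 : fps K) = 0.
Proof. exact: fpsD_natr 0%N. Qed.

Lemma fpsD_dixon_sm n : fpsD (S ^+ n.+1) = n.+1%:R * S ^+ n * C ^+ 2.
Proof. by rewrite fpsD_exp DS. Qed.

Lemma fpsD_dixon_cm n : fpsD (C ^+ n.+1) = - (n.+1%:R * C ^+ n * S ^+ 2).
Proof. by rewrite fpsD_exp DC mulrN. Qed.

Definition fpsD_dixon :=
  (fpsD_add, fpsD_opp, fpsD_mul, fpsD0, fpsD_natr,
   fpsD_dixon_sm, fpsD_dixon_cm, DS, DC).

(** Each derivative changes the exponent of [C] by 2 or -1, so after three of them it is 0, 3 or 6,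
    and the cubic relation eliminates [C]. In the variant with a factor [C], exactly that factor
    remains. *)
Lemma fpsD3_sm n : fpsD (fpsD (fpsD (S ^+ n.+3))) =
  (n%:R + 1) * (n%:R + 2) * (n%:R + 3) * S ^+ n
  - 2 * (n%:R + 3) * ((n%:R + 3) ^+ 2 + 1) * S ^+ n.+3
  + (n%:R + 3) * (n%:R + 4) * (n%:R + 5) * S ^+ (n + 6).
Proof.
have h := dixon_cubes.
rewrite !fpsD_dixon -!natr1 exprD !(exprS S n.+2, exprS S n.+1, exprS S n).
ring: h.
Qed.

Lemma fpsD3_sm_cm n : fpsD (fpsD (fpsD (S ^+ n.+3 * C))) =
  (n%:R + 1) * (n%:R + 2) * (n%:R + 3) * (S ^+ n * C)
  - ((n%:R + 2) * (n%:R + 3) ^+ 2 + (n%:R + 4) ^+ 2 * (n%:R + 5))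
    * (S ^+ n.+3 * C)
  + (n%:R + 4) * (n%:R + 5) * (n%:R + 6) * (S ^+ (n + 6) * C).
Proof.
have h := dixon_cubes.
rewrite !fpsD_dixon -!natr1 exprD !(exprS S n.+2, exprS S n.+1, exprS S n).
ring: h.
Qed.

Let idx (j k : nat) : K := (3 * k + j)%:R.

(** Level [k] carries [S^(3k+j)]. [fpsD3_sm] starts at exponent 3, so the identity at level 0 is a
    hypothesis, with [Q] in the place of the lowering term. With [n = 3k+j], raising contributes
    [n(n+1)(n+2)] and lowering [(n+1)(n+2)(n+3)]. *)
Lemma sm_jfrac j Q N a b :
  fpsD (fpsD (fpsD (S ^+ j))) = Q - fpsC (b 0%N) * S ^+ j
    + (j%:R * (j%:R + 1) * (j%:R + 2)) * S ^+ (j + 3) ->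
  N = fpsX ^+ 3 * fps_laplace Q + fpsC ((S ^+ j) 0%N) * fpsX
     + fpsC (fpsD (S ^+ j) 0%N) * fpsX ^+ 2
     + fpsC (fpsD (fpsD (S ^+ j)) 0%N) * fpsX ^+ 3 ->
  (forall k, a k.+1 = idx j k * (idx j k + 1) ^+ 2 * (idx j k + 2) ^+ 2
                        * (idx j k + 3)) ->
  (forall k, b k = 2 * idx j k * (idx j k ^+ 2 + 1)) ->
  eq_jfrac (fps_laplace (S ^+ j)) N a b.
Proof.
move=> D0 -> aE bE; pose F k := S ^+ (3 * k + j).
apply: (@jfrac_laplace _ a b (fun k => idx j k * (idx j k + 1) * (idx j k + 2))
  (fun k => (idx j k + 1) * (idx j k + 2) * (idx j k + 3)) Q F) => [|k|k|k].
- rewrite D0 /F /idx muln0 add0n muln1 addnC.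
  by rewrite !rmorphM !rmorphD !rmorph_nat.
- have F1 : F k.+1 = S ^+ (3 * k + j).+3 by rewrite /F; congr (_ ^+ _); lia.
  have F2 : F k.+2 = S ^+ (3 * k + j + 6) by rewrite /F; congr (_ ^+ _); lia.
  have i3 : idx j k.+1 = idx j k + 3 by rewrite /idx -natrD; congr _%:R; lia.
  rewrite F1 F2 bE i3 /F /idx; move: (3 * k + j)%N => n.
  rewrite fpsD3_sm; ring.
- have -> : F k.+1 = S ^+ (3 * k + j).+3 by rewrite /F; congr (_ ^+ _); lia.
  rewrite !fpsD_dixon.
  by split; rewrite !(fps_addE, fps_oppE, fps_coef0M, fps_coef0X) S0 !expr0n /=
    ?(mulr0, mul0r, addr0).
- by rewrite aE; ring.
Qed.

(** The extra factor [C] makes the raising and lowering coefficients between consecutive levels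
    equal, which is why the partial numerators are squares. *)
Lemma sm_cm_jfrac j Q N a b :
  fpsD (fpsD (fpsD (S ^+ j * C))) = Q - fpsC (b 0%N) * (S ^+ j * C)
    + ((j%:R + 1) * (j%:R + 2) * (j%:R + 3)) * (S ^+ (j + 3) * C) ->
  N = fpsX ^+ 3 * fps_laplace Q + fpsC ((S ^+ j * C) 0%N) * fpsX
     + fpsC (fpsD (S ^+ j * C) 0%N) * fpsX ^+ 2
     + fpsC (fpsD (fpsD (S ^+ j * C)) 0%N) * fpsX ^+ 3 ->
  (forall k, a k.+1 = (idx j k + 1) ^+ 2 * (idx j k + 2) ^+ 2
                        * (idx j k + 3) ^+ 2) ->
  (forall k, b k = (idx j k - 1) * idx j k ^+ 2
                     + (idx j k + 1) ^+ 2 * (idx j k + 2)) ->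
  eq_jfrac (fps_laplace (S ^+ j * C)) N a b.
Proof.
move=> D0 -> aE bE; pose F k := S ^+ (3 * k + j) * C.
apply: (@jfrac_laplace _ a b
  (fun k => (idx j k + 1) * (idx j k + 2) * (idx j k + 3))
  (fun k => (idx j k + 1) * (idx j k + 2) * (idx j k + 3)) Q F) => [|k|k|k].
- rewrite D0 /F /idx muln0 add0n muln1 addnC.
  by rewrite !rmorphM !rmorphD !rmorph_nat.
- have F1 : F k.+1 = S ^+ (3 * k + j).+3 * C by rewrite /F; congr (_ ^+ _ * _); lia.
  have F2 : F k.+2 = S ^+ (3 * k + j + 6) * C by rewrite /F; congr (_ ^+ _ * _); lia.
  have i3 : idx j k.+1 = idx j k + 3 by rewrite /idx -natrD; congr _%:R; lia.
  rewrite F1 F2 bE i3 /F /idx; move: (3 * k + j)%N => n.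
  rewrite fpsD3_sm_cm; ring.
- have -> : F k.+1 = S ^+ (3 * k + j).+3 * C by rewrite /F; congr (_ ^+ _ * _); lia.
  rewrite !fpsD_dixon.
  by split; rewrite !(fps_addE, fps_oppE, fps_coef0M, fps_coef0X) S0 !expr0n /=
    ?(mulr0, mul0r, addr0).
- by rewrite aE; ring.
Qed.

Lemma fps_laplace0 : fps_laplace (0 : fps K) = 0.
Proof. by apply/funext => -[|n]; rewrite /fps_laplace //= mul0r. Qed.

Lemma fps_laplaceC c : fps_laplace (fpsC c : fps K) = fpsC c * fpsX.
Proof.
apply/funext => -[|[|n]]; rewrite mulrC fps_coefXM /fps_laplace //=.
  by rewrite mulr1.
by rewrite mul0r.
Qed.

Let idxE j k : idx j k = 3 * k%:R + j%:R. Proof. by rewrite /idx natrD natrM. Qed.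

Ltac base_case :=
  rewrite ?expr0 ?expr1 ?mul1r !fpsD_dixon /=; ring: dixon_cubes.
Ltac initial_values :=
  rewrite fps_monoE ?fps_laplace0 ?fps_laplaceC ?expr0 ?expr1 ?mul1r !fpsD_dixon;
  rewrite !(fps_addE, fps_oppE, fps_coef0M, fps_coef0X, fps_coef0, fps_natrE);
  rewrite S0 C0 /=; ring.
Ltac coefficients := by move=> k; rewrite idxE; ring.

Lemma jfrac_sm1 : eq_jfrac (fps_laplace S) (fps_mono 1 2)
  (fun n => (3 * n%:R - 2) * (3 * n%:R - 1) ^+ 2 * (3 * n%:R) ^+ 2
              * (3 * n%:R + 1))
  (fun n => 2 * (3 * n%:R + 1) * ((3 * n%:R + 1) ^+ 2 + 1)).
Proof.
apply: (@sm_jfrac 1 0); [base_case|initial_values|coefficients|coefficients].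
Qed.

Lemma jfrac_sm2 : eq_jfrac (fps_laplace (S ^+ 2)) (fps_mono 2 3)
  (fun n => (3 * n%:R - 1) * (3 * n%:R) ^+ 2 * (3 * n%:R + 1) ^+ 2
              * (3 * n%:R + 2))
  (fun n => 2 * (3 * n%:R + 2) * ((3 * n%:R + 2) ^+ 2 + 1)).
Proof.
apply: (@sm_jfrac 2 0); [base_case|initial_values|coefficients|coefficients].
Qed.

Lemma jfrac_sm3 : eq_jfrac (fps_laplace (S ^+ 3)) (fps_mono 6 4)
  (fun n => (3 * n%:R) * (3 * n%:R + 1) ^+ 2 * (3 * n%:R + 2) ^+ 2
              * (3 * n%:R + 3))
  (fun n => 2 * (3 * n%:R + 3) * ((3 * n%:R + 3) ^+ 2 + 1)).
Proof.
(* Here the lowering term of the third derivative is [6 * S^0], a nonzero constant; its transform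
   gives the numerator [6 x^4]. In the other five cases this coefficient vanishes. *)
apply: (@sm_jfrac 3 (fpsC 6)); [base_case|initial_values|coefficients|coefficients].
Qed.

Lemma jfrac_cm : eq_jfrac (fps_laplace C) (fps_mono 1 1)
  (fun n => (3 * n%:R - 2) ^+ 2 * (3 * n%:R - 1) ^+ 2 * (3 * n%:R) ^+ 2)
  (fun n => (3 * n%:R - 1) * (3 * n%:R) ^+ 2
              + (3 * n%:R + 1) ^+ 2 * (3 * n%:R + 2)).
Proof.
rewrite -[C in eq_jfrac (fps_laplace C)]mul1r.
apply: (@sm_cm_jfrac 0 0); [base_case|initial_values|coefficients|coefficients].
Qed.

Lemma jfrac_sm_cm : eq_jfrac (fps_laplace (S * C)) (fps_mono 1 2)
  (fun n => (3 * n%:R - 1) ^+ 2 * (3 * n%:R) ^+ 2 * (3 * n%:R + 1) ^+ 2)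
  (fun n => (3 * n%:R) * (3 * n%:R + 1) ^+ 2
              + (3 * n%:R + 2) ^+ 2 * (3 * n%:R + 3)).
Proof.
apply: (@sm_cm_jfrac 1 0); [base_case|initial_values|coefficients|coefficients].
Qed.

Lemma jfrac_sm2_cm : eq_jfrac (fps_laplace (S ^+ 2 * C)) (fps_mono 2 3)
  (fun n => (3 * n%:R) ^+ 2 * (3 * n%:R + 1) ^+ 2 * (3 * n%:R + 2) ^+ 2)
  (fun n => (3 * n%:R + 1) * (3 * n%:R + 2) ^+ 2
              + (3 * n%:R + 3) ^+ 2 * (3 * n%:R + 4)).
Proof.
apply: (@sm_cm_jfrac 2 0); [base_case|initial_values|coefficients|coefficients].
Qed.
End FormalDixon.

(** * Convergent expansions *)

Definition psum (K : numFieldType) (p : nat -> K) (u : K) (n : nat) : K :=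
  \sum_(i < n) p i * u ^+ i.

(** The Cauchy-type bound is kept next to convergence because it yields explicit geometric tail
    estimates without completeness of [K]. *)
Definition expands_in (K : numFieldType) (r M : K) (f : K -> K) (p : fps K) :=
  [/\ 0 < r, forall n, `|p n| * r ^+ n <= M &
      forall u, `|u| < r -> psum p u @ \oo --> f u]%classic.

Definition expands (K : numFieldType) (f : K -> K) (p : fps K) :=
  exists r M, expands_in r M f p.

Section PowerSeries.
Variable K : numFieldType.
Implicit Types (f g : K -> K) (p q : fps K) (r M u h : K).

Lemma expands_in_ge0 r M f p : expands_in r M f p -> 0 <= M.
Proof. by case=> r0 pM _; apply: le_trans (pM 0%N); rewrite expr0 mulr1. Qed.

Lemma expands_in_le r s M f p : 0 < s -> s <= r ->
  expands_in r M f p -> expands_in s M f p.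
Proof.
move=> s0 sr [r0 pM cv]; split=> // [n|u us]; last first.
  exact: cv (lt_le_trans us sr).
by apply: le_trans (pM n); rewrite ler_wpM2l // lerXn2r // nnegrE ltW.
Qed.

Lemma expands_in_common r1 M1 f1 p1 r2 M2 f2 p2 :
  expands_in r1 M1 f1 p1 -> expands_in r2 M2 f2 p2 ->
  exists r, expands_in r M1 f1 p1 /\ expands_in r M2 f2 p2.
Proof.
move=> e1 e2; have [r10 _ _] := e1; have [r20 _ _] := e2.
have s0 : 0 < r1 + r2 by rewrite addr_gt0.
have r0 : 0 < r1 * r2 / (r1 + r2) by rewrite divr_gt0 ?mulr_gt0.
(* This quotient lies below both radii, so they never have to be compared with each other. *)
exists (r1 * r2 / (r1 + r2)); split.
  apply: expands_in_le e1 => //.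
  by rewrite ler_pdivrMr // ler_wpM2l ?ltW // ltrDr.
apply: expands_in_le e2 => //.
by rewrite ler_pdivrMr // mulrC ler_wpM2l ?ltW // ltrDl.
Qed.

Lemma geometric_half_le (q : K) n : 0 <= q -> q <= 2^-1 ->
  \sum_(i < n) q ^+ i <= 2.
Proof.
move=> q0 q2; elim: n => [|n IHn]; first by rewrite big_ord0.
rewrite big_ord_recl expr0; under eq_bigr do rewrite exprS.
rewrite -mulr_sumr -[2]/(1 + 1) lerD2l.
apply: le_trans (_ : 2^-1 * 2 <= 1); last by rewrite mulVf ?pnatr_eq0.
by apply: ler_pM => //; apply: sumr_ge0 => i _; rewrite exprn_ge0.
Qed.

Lemma expands_in_term r M f p u n : expands_in r M f p ->
  `|p n * u ^+ n| <= M * (`|u| / r) ^+ n.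
Proof.
case=> r0 pM _; rewrite normrM normrX expr_div_n.
rewrite mulrA ler_pdivlMr ?exprn_gt0 // -mulrA [_ ^+ n * _]mulrC mulrA.
by rewrite ler_wpM2r ?exprn_ge0.
Qed.

(** The terms are dominated by a geometric series of ratio at most 1/2. The bound does not depend on
    [k] and so passes to the limit. *)
Lemma psum_tail r M f p u n k : expands_in r M f p -> `|u| / r <= 2^-1 ->
  `|psum p u (n + k) - psum p u n| <= 2 * M * (`|u| / r) ^+ n.
Proof.
move=> e q2; have M0 := expands_in_ge0 e; have [r0 _ _] := e.
have q0 : 0 <= `|u| / r by rewrite divr_ge0 // ltW.
rewrite /psum big_split_ord /= addrAC subrr add0r.
apply: le_trans (ler_norm_sum _ _ _) _.
apply: le_trans (_ : \sum_(i < k) M * (`|u| / r) ^+ n * (`|u| / r) ^+ i <= _).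
  apply: ler_sum => i _; rewrite -mulrA -exprD.
  exact: (expands_in_term _ _ e).
rewrite -mulr_sumr -[2 * M * _]mulrA [2 * (M * _)]mulrC.
rewrite ler_wpM2l ?mulr_ge0 ?exprn_ge0 //.
exact: geometric_half_le.
Qed.

Lemma cvg_norm_le (x : nat -> K) (l a B : K) (N : nat) :
  (x @ \oo --> l)%classic -> (forall n, (N <= n)%N -> `|x n - a| <= B) ->
  `|l - a| <= B.
Proof.
move=> /cvgrPdist_le xl xB; apply/ler_addgt0Pl => e e0.
have [N' _ H] := xl e e0.
have := H _ (leq_maxr N N'); have := xB _ (leq_maxl N N').
set y := x _ => h1 h2.
have -> : l - a = (l - y) + (y - a) by ring.
by apply: le_trans (ler_normD _ _) _; rewrite lerD.
Qed.

Lemma expands_in_tail r M f p u n : expands_in r M f p -> `|u| / r <= 2^-1 ->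
  `|f u - psum p u n| <= 2 * M * (`|u| / r) ^+ n.
Proof.
move=> e q2; have [r0 _ cv] := e.
have ur : `|u| < r.
  move: q2; rewrite ler_pdivrMr // => /le_lt_trans; apply.
  by rewrite gtr_pMl // invf_lt1 // ltr1n.
apply: (@cvg_norm_le (psum p u) _ _ _ n); first exact: cv.
by move=> m lenm; rewrite -(subnKC lenm); exact: (psum_tail _ _ e q2).
Qed.

(** If [p n] is the first nonzero coefficient, the tail estimate at [u = r * t] bounds [|p n| r^n]
    by [2 M t], which fails for small [t]. *)
Lemma expands_in_inj0 r M p : expands_in r M (fun=> 0) p -> p = 0.
Proof.
move=> e; have M0 := expands_in_ge0 e; have [r0 _ _] := e.
apply/funext => n; elim/ltn_ind: n => n IHn; apply/eqP; apply: contraT => pn.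
rewrite -[X in _ == X]/(0 : K) in pn.
pose x := `|p n| * r ^+ n.
have x0 : 0 < x by rewrite mulr_gt0 ?normr_gt0 ?exprn_gt0.
have d0 : 0 < x + 2 * M by rewrite ltr_wpDr ?mulr_ge0.
(* This choice ensures both [t <= 1/2], as the tail estimate requires, and [2 M t < x]. *)
pose t := x / (2 * (x + 2 * M)).
have t0 : 0 < t by rewrite divr_gt0 // mulr_gt0.
have rt0 : 0 <= r * t by rewrite ltW // mulr_gt0.
have normu : `|r * t| / r = t by rewrite ger0_norm // mulrAC mulfV ?mul1r ?gt_eqF.
have := @expands_in_tail _ _ _ _ (r * t) n.+1 e.
rewrite normu /psum big_ord_recr big1 /= ?add0r => [|i _]; last first.
  by rewrite IHn // mul0r.
rewrite normrN normrM normrX [`|r * t|]ger0_norm //.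
rewrite exprMn mulrA -/x exprSr mulrA [_ * t ^+ n * t]mulrAC.
rewrite ler_pM2r ?exprn_gt0 // => /(_ _) H.
have {}H : x <= 2 * M * t.
  apply: H; rewrite /t ler_pdivrMr ?mulr_gt0 // mulrA mulVf ?pnatr_eq0 // mul1r.
  by rewrite lerDl mulr_ge0.
move: H; rewrite /t mulrA ler_pdivlMr ?mulr_gt0 // mulrC ler_pM2r //.
rewrite ler_pM2l // => /(lt_le_trans (_ : M < x + 2 * M)).
by rewrite ltxx => -> //; rewrite mulrDl mul1r addrA ltrDr ltr_wpDr.
Qed.
Lemma expands_inj f p q : expands f p -> expands f q -> p = q.
Proof.
move=> [r1 [M1 e1]] [r2 [M2 e2]].
have [r [[r0 b1 cv1] [_ b2 cv2]]] := expands_in_common e1 e2.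
apply: subr0_eq; apply: (expands_in_inj0 (r := r) (M := M1 + M2)); split=> // [n|u ur].
  apply: le_trans (_ : (`|p n| + `|q n|) * r ^+ n <= _); last by rewrite mulrDl lerD.
  by rewrite ler_wpM2r ?ler_normB // exprn_ge0 // ltW.
rewrite -[X in (_ --> X)%classic](subrr (f u)).
suff -> : psum (p - q) u = psum p u - psum q u.
  by apply: cvgB; [exact: cv1|exact: cv2].
apply/funext => n; rewrite /psum -[RHS]/(_ - _) -sumrB.
by apply: eq_bigr => i _; rewrite -mulrBl.
Qed.

Lemma has_egf_expands f t :
  has_egf f t -> expands f (fun n => t n / n`!%:R).
Proof.
move=> /nbhs_norm0P[e /= e0 cv]; pose r := e / 2.
have r0 : 0 < r by rewrite divr_gt0.
have re : r < e by rewrite ltr_pdivrMr // ltr_pMr // ltr1n.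
have psumE u : psum (fun n => t n / n`!%:R) u =
    series (fun n => t n * u ^+ n / n`!%:R).
  apply/funext => n; rewrite /series /= big_mkord.
  by apply: eq_bigr => i _; rewrite mulrAC.
(* The terms of a series convergent at the single point [r] tend to 0 and are thus bounded.
   [bounded_fun] only gives bounds strictly above [M], hence [M + 1] below. *)
have [M [_ HM]] : bounded_fun (fun n => t n * r ^+ n / n`!%:R).
  apply: cvg_seq_bounded; apply/cvg_ex; exists 0.
  apply: cvg_series_cvg_0; apply/cvg_ex; exists (f r).
  by apply: cv; rewrite /= ger0_norm // ltW.
exists r, (M + 1); split=> // [n|u ur]; last first.
  by rewrite psumE; exact: cv (lt_trans ur re).
have := HM (M + 1) _ n I; rewrite ltrDl ltr01 => /(_ isT) /=.
by rewrite mulrAC normrM normrX (ger0_norm (ltW r0)).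
Qed.

Lemma expands_has_egf f p : expands f p -> has_egf f (fun n => p n * n`!%:R).
Proof.
move=> [r [M [r0 _ cv]]]; apply/nbhs_norm0P; exists r => //= u ur.
suff -> : series (fun n => p n * n`!%:R * u ^+ n / n`!%:R) = psum p u by exact: cv.
apply/funext => n; rewrite /series /= big_mkord.
by apply: eq_bigr => i _; rewrite mulrAC mulfK // pnatr_eq0 -lt0n fact_gt0.
Qed.

(** Expansions are unique, so one expansion settles the claim for every admissible [t]. *)
Lemma laplace_eq_jfrac_expands f p N a b :
  expands f p -> eq_jfrac (fps_laplace p) N a b -> laplace_eq_jfrac f N a b.
Proof.
move=> fp pJ; split; first by exists (fun n => p n * n`!%:R); exact: expands_has_egf.
move=> t /has_egf_expands ft.
suff -> : formal_laplace t = fps_laplace p by [].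
rewrite (expands_inj fp ft); congr formal_laplace; apply/funext => n.
by rewrite divfK // pnatr_eq0 -lt0n fact_gt0.
Qed.

(** Sums the triangle of index pairs [i + j < n] by rows; comparison with the full square then only
    involves tails of [q]. *)
Lemma psum_mul p q u n :
  psum (p * q) u n = \sum_(i < n) p i * u ^+ i * psum q u (n - i).
Proof.
elim: n => [|n IHn]; first by rewrite /psum !big_ord0.
rewrite [LHS]big_ord_recr /= -/(psum (p * q) u n) IHn fps_mulE /fps_mul mulr_suml.
rewrite big_ord_recr /= [RHS]big_ord_recr /= addrA.
rewrite subSn // subnn -big_split /=; congr (_ + _).
  apply: eq_bigr => i _; rewrite subSn ?(ltnW (ltn_ord i)) //.
  rewrite [in RHS]/psum big_ord_recr /=.
  rewrite -/(psum q u (n - i)) mulrDr; congr (_ + _).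
  have -> : u ^+ n = u ^+ i * u ^+ (n - i) by rewrite -exprD subnKC // ltnW.
  ring.
by rewrite /psum big_ord1 expr0; ring.
Qed.

Lemma ler_natr_exp2 n : (n%:R : K) <= 2 ^+ n.
Proof. by rewrite -natrX ler_nat ltnW // ltn_expl. Qed.

Hypothesis archi : Num.archimedean_axiom K.

(** The Archimedean axiom and [n <= 2^n] make [2^-n] tend to 0. *)
Lemma cvg_half (x : nat -> K) (l B : K) :
  (forall n, `|l - x n| <= B * 2^-1 ^+ n) -> (x @ \oo --> l)%classic.
Proof.
move=> xB; apply/cvgrPdist_le => e e0; have [N BN] := archi (B / e).
have B0 : 0 <= B by have := xB 0%N; rewrite expr0 mulr1; exact: le_trans.
exists N => // n /= leNn; apply: le_trans (xB n) _.
rewrite exprVn ler_pdivrMr ?exprn_gt0 // -ler_pdivrMl // mulrC.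
move: BN; rewrite ger0_norm ?divr_ge0 ?(ltW e0) // => /ltW /le_trans -> //.
by apply: le_trans (ler_natr_exp2 n); rewrite ler_nat.
Qed.

Lemma expands_mul f g p q :
  expands f p -> expands g q -> expands (fun u => f u * g u) (p * q).
Proof.
move=> [r1 [M1 e1]] [r2 [M2 e2]].
have [r [{}e1 {}e2]] := expands_in_common e1 e2.
have M10 := expands_in_ge0 e1; have M20 := expands_in_ge0 e2.
have [r0 b1 cv1] := e1; have [_ b2 cv2] := e2.
(* With radius [r / 4], the factor [4^n] absorbs the [n + 1] summands of a Cauchy coefficient, and
   [n * 4^-n <= 2^-n] controls the error [E] below. *)
have r40 : 0 < r / 4 by rewrite divr_gt0.
exists (r / 4), (M1 * M2); split=> // [n|u ur].
  rewrite expr_div_n mulrA ler_pdivrMr ?exprn_gt0 // fps_mulE /fps_mul.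
  apply: le_trans (_ : \sum_(i < n.+1) M1 * M2 <= _).
    apply: le_trans (ler_wpM2r _ (ler_norm_sum _ _ _)) _.
      by rewrite exprn_ge0 // ltW.
    rewrite mulr_suml; apply: ler_sum => i _.
    have -> : r ^+ n = r ^+ i * r ^+ (n - i) by rewrite -exprD subnKC // -ltnS.
    rewrite normrM mulrACA.
    by apply: ler_pM; rewrite ?b1 ?b2 ?mulr_ge0 // exprn_ge0 // ltW.
  rewrite sumr_const card_ord -[_ *+ n.+1]mulr_natr ler_wpM2l ?mulr_ge0 //.
  by rewrite -natrX ler_nat ltn_expl.
have uq : `|u| / r <= 2^-1 * 2^-1.
  rewrite ler_pdivrMr // mulrC -invfM -natrM; exact: ltW.
have q0 : 0 <= `|u| / r by rewrite divr_ge0 // ltW.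
have uq2 : `|u| / r <= 2^-1.
  by apply: le_trans uq _; rewrite ler_piMr // invf_le1 // ler1n.
have urr : `|u| < r.
  by apply: lt_trans ur _; rewrite ltr_pdivrMr // ltr_pMr // ltr1n.
have cvM := cvgM (cv1 u urr) (cv2 u urr).
pose E : nat -> K := fun n => psum p u n * psum q u n - psum (p * q) u n.
suff cv0 : (E @ \oo --> (0 : K))%classic.
  have -> : psum (p * q) u = (psum p u \* psum q u) - E.
    apply/funext => n; rewrite -[RHS]/(psum p u n * psum q u n - E n) /E.
    by rewrite opprB addrC subrK.
  by rewrite -[f u * g u]subr0; exact: cvgB (cvM _) cv0.
apply: (@cvg_half _ _ (M1 * (2 * M2))) => n.
rewrite sub0r normrN /E psum_mul {1}/psum mulr_suml -sumrB.
apply: le_trans (ler_norm_sum _ _ _) _.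
apply: le_trans (_ : \sum_(i < n) M1 * (2 * M2) * (`|u| / r) ^+ n <= _).
  apply: ler_sum => i _; rewrite -mulrBr normrM.
  have ltin := ltnW (ltn_ord i).
  rewrite -[in X in _ <= X](subnKC ltin) exprD mulrACA.
  apply: ler_pM => //; first exact: expands_in_term e1.
  have := psum_tail (n - i) i e2 uq2.
  by rewrite subnK.
rewrite sumr_const card_ord -[_ *+ n]mulr_natr -mulrA ler_wpM2l ?mulr_ge0 //.
apply: le_trans (_ : (2^-1 * 2^-1) ^+ n * 2 ^+ n <= _).
  by apply: ler_pM; rewrite ?exprn_ge0 ?ler_natr_exp2 // lerXn2r ?nnegrE // mulr_ge0.
by rewrite -exprMn -mulrA mulVf ?mulr1 // pnatr_eq0.
Qed.

(** Induction: the remainder for [n + 1] is [u + h] times that for [n], plus [h^2 * n * u^(n-1)],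
    and [n^2 + n <= (n+1)^2]. The factor [s^2] avoids the exponent [n - 2]. *)
Lemma exprD_taylor1 u h (s : K) n : `|u| <= s -> `|u + h| <= s ->
  `|(u + h) ^+ n - u ^+ n - n%:R * h * u ^+ n.-1| * s ^+ 2 <=
    `|h| ^+ 2 * n%:R ^+ 2 * s ^+ n.
Proof.
move=> us uhs; have s0 : 0 <= s by apply: le_trans us.
elim: n => [|n IHn].
  by rewrite !expr0 subrr !mul0r subr0 normr0 mul0r expr0n /= mulr0 mul0r.
have -> : (u + h) ^+ n.+1 - u ^+ n.+1 - n.+1%:R * h * u ^+ n.+1.-1 =
    (u + h) * ((u + h) ^+ n - u ^+ n - n%:R * h * u ^+ n.-1)
    + h ^+ 2 * (n%:R * u ^+ n.-1).
  by case: n {IHn} => [|n] /=; rewrite ?expr0 ?expr1 -?natr1 ?exprS; ring.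
have H2 : `|n%:R * u ^+ n.-1| * s ^+ 2 <= n%:R * s ^+ n.+1.
  case: n {IHn} => [|n] /=; first by rewrite !mul0r normr0 mul0r.
  rewrite normrM normr_nat normrX -mulrA ler_wpM2l //.
  have -> : s ^+ n.+2 = s ^+ n * s ^+ 2 by rewrite -exprD addn2.
  by rewrite ler_wpM2r ?exprn_ge0 // lerXn2r.
apply: le_trans (ler_wpM2r _ (ler_normD _ _)) _; first by rewrite exprn_ge0.
rewrite mulrDl normrM [`|h ^+ 2 * _|]normrM normrX.
rewrite -[X in X + _ <= _]mulrA -[X in _ + X <= _]mulrA.
apply: le_trans (_ : s * (`|h| ^+ 2 * n%:R ^+ 2 * s ^+ n)
  + `|h| ^+ 2 * (n%:R * s ^+ n.+1) <= _).
  apply: lerD; last by rewrite ler_wpM2l ?exprn_ge0.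
  by apply: ler_pM; rewrite // mulr_ge0 // exprn_ge0.
rewrite -[n.+1%:R]natr1 [s ^+ n.+1]exprS -subr_ge0.
rewrite [X in 0 <= X](_ : _ = `|h| ^+ 2 * s * s ^+ n * (n%:R + 1)); last by ring.
by rewrite !mulr_ge0 ?exprn_ge0 // natr1.
Qed.

(* The difference quotients of the partial sums converge to that of [f] as the
   number of terms grows, and differ from the termwise derivatives by [O(h)]
   uniformly in the number of terms. *)
Lemma expands_deriv f g p : expands f p ->
  (\forall u \near (0 : K), is_derive u (1 : K) f (g u)) ->
  expands g (fpsD p).
Proof.
move=> [r [M e]] /nbhs_norm0P[d /= d0 df]; have M0 := expands_in_ge0 e.
have [r0 b cv] := e.
(* Since [8 = 2 * 4], the factor [4^-i] absorbs the [i^2] of the Taylor remainder and [2^-i] leaves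
   a summable series. Halving [s] to [t] keeps both [u] and [u + h] within [s]. *)
pose s := r / 8; have s0 : 0 < s by rewrite divr_gt0.
pose t := s / 2; have t0 : 0 < t by rewrite divr_gt0.
have st : s = t + t by rewrite -splitr.
have sr : s < r by rewrite ltr_pdivrMr // ltr_pMr // ltr1n.
pose w := t * d / (t + d).
have w0 : 0 < w by rewrite divr_gt0 // ?mulr_gt0 // addr_gt0.
have wt : w < t.
  by rewrite ltr_pdivrMr ?addr_gt0 // ltr_pM2l // ltrDr.
have wd : w < d.
  by rewrite ltr_pdivrMr ?addr_gt0 // mulrC ltr_pM2l // ltrDl.
(* The bound follows from [w <= r / 2] and [n + 1 <= 2^n]. *)
exists w, (M / r); split=> // [n|u uw].
  rewrite /fpsD -mulr_natr normrM normr_nat ler_pdivlMr //.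
  have wr : w <= r / 2.
    apply: le_trans (ltW wt) _; rewrite /t ler_pM2r ?invr_gt0 //; exact: ltW.
  apply: le_trans (_ : `|p n.+1| * n.+1%:R * (r / 2) ^+ n * r <= _).
    rewrite ler_pM2r // ler_wpM2l ?mulr_ge0 // lerXn2r // nnegrE ltW //.
    by rewrite divr_gt0.
  have -> : `|p n.+1| * n.+1%:R * (r / 2) ^+ n * r =
      `|p n.+1| * r ^+ n.+1 * (n.+1%:R / 2 ^+ n).
    by rewrite expr_div_n exprS; ring.
  rewrite -[M]mulr1; apply: ler_pM => //.
  - by rewrite mulr_ge0 // exprn_ge0 // ltW.
  - by rewrite ler_pdivrMr ?exprn_gt0 // mul1r -natrX ler_nat ltn_expl.
have ut : `|u| < t by exact: lt_trans uw wt.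
have ud : `|u| < d by exact: lt_trans uw wd.
have [dfu gE] := df u ud.
apply/cvgrPdist_le => eps eps0.
pose B := 2 * M / s ^+ 2.
have B0 : 0 <= B.
  by rewrite /B mulr_ge0 ?invr_ge0 ?exprn_ge0 ?(ltW s0) ?mulr_ge0.
have e30 : 0 < eps / 3 by rewrite divr_gt0.
(* A single increment [h] is fixed before the number of terms grows: small enough for the difference
   quotient of [f] and for the uniform error [B * |h|]. *)
have : exists h, [/\ h != 0, `|h| <= t, B * `|h| <= eps / 3 &
    `|g u - (f (u + h) - f u) / h| <= eps / 3].
  have cvD : ((fun h => h^-1 *: (f (h *: (1 : K) + u) - f u)) @ (0 : K)^'
              --> g u)%classic.
    by rewrite -gE; exact: dfu.
  move/cvgrPdist_le: cvD => /(_ _ e30) near_g.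
  have b0 : 0 < eps / 3 / (B + 1) by rewrite divr_gt0 // ltr_wpDl.
  near (0 : K)^'%classic => h; exists h; split.
  - by near: h; exact: nbhs_dnbhs_neq.
  - by near: h; exact: dnbhs0_le.
  - have hb : `|h| <= eps / 3 / (B + 1) by near: h; exact: dnbhs0_le.
    apply: le_trans (_ : (B + 1) * `|h| <= _).
      by rewrite ler_wpM2r // lerDl.
    by move: hb; rewrite ler_pdivlMr ?ltr_wpDl // mulrC.
  - rewrite [u + h]addrC [_ / h]mulrC; near: h.
    by apply: filterS near_g => h /=; rewrite scaler1.
move=> [h [h0 ht hB hg]].
have us : `|u| <= s by rewrite st ltW // ltr_wpDr // ltW.
have uhs : `|u + h| <= s.
  by rewrite st; apply: le_trans (ler_normD _ _) _; rewrite lerD // ltW.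
pose P n := (psum p (u + h) n - psum p u n) / h.
(* The shift to [n.+1] reflects that differentiating [n + 1] terms kills the constant one. *)
have key n : `|P n.+1 - psum (fpsD p) u n| <= eps / 3.
  apply: le_trans hB.
  have -> : P n.+1 - psum (fpsD p) u n =
     (\sum_(i < n.+1) p i * ((u + h) ^+ i - u ^+ i - i%:R * h * u ^+ i.-1)) / h.
    rewrite /P; under [in RHS]eq_bigr do rewrite mulrBr.
    rewrite sumrB [RHS]mulrBl; congr (_ / h - _).
      by rewrite -sumrB; apply: eq_bigr => i _; rewrite mulrBr.
    rewrite big_ord_recl /= !mul0r mulr0 add0r mulr_suml; apply: eq_bigr => i _.
    rewrite /fpsD /bump /= add1n -mulr_natr; by field.
  rewrite normrM normfV ler_pdivrMr ?normr_gt0 // -mulrA -expr2.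
  rewrite /B mulrAC ler_pdivlMr ?exprn_gt0 //.
  apply: le_trans (ler_wpM2r _ (ler_norm_sum _ _ _)) _.
    by rewrite exprn_ge0 // ltW.
  rewrite mulr_suml.
  apply: le_trans (_ : \sum_(i < n.+1) M * `|h| ^+ 2 * 2^-1 ^+ i <= _).
    apply: ler_sum => i _; rewrite normrM -mulrA.
    apply: le_trans (ler_wpM2l (normr_ge0 _) (exprD_taylor1 i us uhs)) _.
    have -> : s ^+ i = r ^+ i * (2^-1 ^+ i * 4^-1 ^+ i).
      by rewrite -!exprMn /s; congr (_ ^+ _); field.
    rewrite [X in X <= _](_ : _ = (`|p i| * r ^+ i) * `|h| ^+ 2 * 2^-1 ^+ i
      * (i%:R ^+ 2 * 4^-1 ^+ i)); last by ring.
    rewrite -[X in _ <= X]mulr1; apply: ler_pM.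
    - by rewrite !mulr_ge0 // ?exprn_ge0 // ?invr_ge0 // ltW.
    - by rewrite mulr_ge0 // exprn_ge0 // invr_ge0.
    - by rewrite !ler_wpM2r ?exprn_ge0 ?invr_ge0.
    - rewrite exprVn ler_pdivrMr ?exprn_gt0 // mul1r.
      rewrite -[4]/(4%:R) (natrM _ 2 2) exprMn expr2.
      by apply: ler_pM; rewrite ?ler_natr_exp2.
  rewrite -mulr_sumr -[2 * M * _]mulrA [2 * (M * _)]mulrC ler_wpM2l //.
    by rewrite mulr_ge0 // exprn_ge0.
  by apply: geometric_half_le; rewrite ?invr_ge0.
have cvP : (P @ \oo --> (f (u + h) - f u) / h)%classic.
  apply: cvgMl; apply: cvgB; apply: cv.
    exact: le_lt_trans uhs sr.
  exact: le_lt_trans us sr.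
move/cvgrPdist_le: cvP => /(_ _ e30)[N _ HN].
exists N => // n /= leNn.
have := HN n.+1 (leqW leNn) => /= HN'.
have -> : eps = eps / 3 + (eps / 3 + eps / 3) by field.
have -> : g u - psum (fpsD p) u n = (g u - (f (u + h) - f u) / h) +
   (((f (u + h) - f u) / h - P n.+1) + (P n.+1 - psum (fpsD p) u n)) by ring.
apply: le_trans (ler_normD _ _) _; apply: lerD => //.
apply: le_trans (ler_normD _ _) _; exact: lerD.
Unshelve. all: by end_near.
Qed.
End PowerSeries.

Lemma expands_opp (K : numFieldType) (f : K -> K) p :
  expands f p -> expands (fun u => - f u) (- p).
Proof.
move=> [r [M [r0 b cv]]]; exists r, M; split=> // [n|u ur].
  by rewrite fps_oppE normrN.
suff -> : psum (- p) u = - psum p u by apply: cvgN; exact: cv.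
apply/funext => n; rewrite -[RHS]/(- psum p u n) /psum -sumrN.
by apply: eq_bigr => i _; rewrite mulNr.
Qed.

Lemma expands_at0 (K : numFieldType) (f : K -> K) p : expands f p -> p 0%N = f 0.
Proof.
move=> [r [M e]]; have := @expands_in_tail _ _ _ _ _ 0 1 e.
rewrite normr0 mul0r invr_ge0 ler0n => /(_ isT).
rewrite expr1 mulr0 normr_le0 /psum big_ord1 expr0 mulr1 subr_eq0.
by move=> /eqP.
Qed.

Lemma complex_archimedean (R : realType) : Num.archimedean_axiom R[i].
Proof.
move=> x; rewrite normc_def; set y : R := Num.sqrt _.
exists (Num.bound y); rewrite -(rmorph_nat (@real_complex R)) ltcR.
by apply: archi_boundP; rewrite sqrtr_ge0.
Qed.

(** * From the analytic Dixon functions to their formal expansions *)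

Section DixonExpansion.
Variables (K : numFieldType) (sm cm : K -> K).
Hypothesis archi : Num.archimedean_axiom K.

Lemma expands_exp (f : K -> K) p n :
  expands f p -> expands (fun u => f u ^+ n.+1) (p ^+ n.+1).
Proof.
move=> fp; elim: n => [|n IHn] //.
rewrite exprS; rewrite (_ : (fun u => _) = fun u => f u * f u ^+ n.+1); last first.
  by apply/funext => u; rewrite exprS.
exact: expands_mul.
Qed.

(** Both sides of each formal differential equation expand the same function, so uniqueness of
    expansions identifies them. *)
Lemma dixon_expansion : is_sm_cm sm cm ->
  exists S C : fps K, [/\ expands sm S /\ expands cm C, fpsD S = C ^+ 2,
    fpsD C = - S ^+ 2, S 0%N = 0 & C 0%N = 1].
Proof.
move=> [[[s /has_egf_expands smS] [c /has_egf_expands cmC]] dsm dcm sm0 cm0].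
do 2!eexists; split; [by split; [exact: smS|exact: cmC]| | | |].
- apply: (expands_inj (f := fun u => cm u ^+ 2)); first exact: expands_deriv dsm.
  exact: expands_exp.
- apply: (expands_inj (f := fun u => - sm u ^+ 2)); first exact: expands_deriv dcm.
  by apply: expands_opp; exact: expands_exp.
- exact: etrans (expands_at0 smS) sm0.
- exact: etrans (expands_at0 cmC) cm0.
Qed.
End DixonExpansion.

Theorem mainTheorem1 (R : realType) (sm cm : R[i] -> R[i])
    (sm_cm : is_sm_cm sm cm) :
  [/\ (* (1) *)
      laplace_eq_jfrac (fun u => sm u) (fps_mono 1 2)
        (fun n => (3 * n%:R - 2) * (3 * n%:R - 1) ^+ 2 * (3 * n%:R) ^+ 2
                    * (3 * n%:R + 1))
        (fun n => 2 * (3 * n%:R + 1) * ((3 * n%:R + 1) ^+ 2 + 1)),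
      (* (2) *)
      laplace_eq_jfrac (fun u => sm u ^+ 2) (fps_mono 2 3)
        (fun n => (3 * n%:R - 1) * (3 * n%:R) ^+ 2 * (3 * n%:R + 1) ^+ 2
                    * (3 * n%:R + 2))
        (fun n => 2 * (3 * n%:R + 2) * ((3 * n%:R + 2) ^+ 2 + 1)) &
      (* (3) *)
      laplace_eq_jfrac (fun u => sm u ^+ 3) (fps_mono 6 4)
        (fun n => (3 * n%:R) * (3 * n%:R + 1) ^+ 2 * (3 * n%:R + 2) ^+ 2
                    * (3 * n%:R + 3))
        (fun n => 2 * (3 * n%:R + 3) * ((3 * n%:R + 3) ^+ 2 + 1))]
  /\
  [/\ (* (4) *)
      laplace_eq_jfrac (fun u => cm u) (fps_mono 1 1)
        (fun n => (3 * n%:R - 2) ^+ 2 * (3 * n%:R - 1) ^+ 2 * (3 * n%:R) ^+ 2)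
        (fun n => (3 * n%:R - 1) * (3 * n%:R) ^+ 2
                    + (3 * n%:R + 1) ^+ 2 * (3 * n%:R + 2)),
      (* (5) *)
      laplace_eq_jfrac (fun u => sm u * cm u) (fps_mono 1 2)
        (fun n => (3 * n%:R - 1) ^+ 2 * (3 * n%:R) ^+ 2 * (3 * n%:R + 1) ^+ 2)
        (fun n => (3 * n%:R) * (3 * n%:R + 1) ^+ 2
                    + (3 * n%:R + 2) ^+ 2 * (3 * n%:R + 3)) &
      (* (6) *)
      laplace_eq_jfrac (fun u => sm u ^+ 2 * cm u) (fps_mono 2 3)
        (fun n => (3 * n%:R) ^+ 2 * (3 * n%:R + 1) ^+ 2 * (3 * n%:R + 2) ^+ 2)
        (fun n => (3 * n%:R + 1) * (3 * n%:R + 2) ^+ 2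
                    + (3 * n%:R + 3) ^+ 2 * (3 * n%:R + 4))].
Proof.
have archi := @complex_archimedean R.
have [S [C [[smS cmC] DS DC S0 C0]]] := dixon_expansion archi sm_cm.
have smX n := expands_exp archi n smS.
split; split; apply: laplace_eq_jfrac_expands.
- exact: smS.
- exact: (jfrac_sm1 DS DC S0 C0).
- exact: smX.
- exact: (jfrac_sm2 DS DC S0 C0).
- exact: smX.
- exact: (jfrac_sm3 DS DC S0 C0).
- exact: cmC.
- exact: (jfrac_cm DS DC S0 C0).
- exact: expands_mul smS cmC.
- exact: (jfrac_sm_cm DS DC S0 C0).
- exact: expands_mul (smX 1%N) cmC.
- exact: (jfrac_sm2_cm DS DC S0 C0).
Qed.
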